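(* Let $X,Y,Z,W$ be normed spaces and let $f:X\times Y\times Z\to W$ be a bounded tri-linear map. The following statements are equivalent: (1) $f$ is completely regular. (2) $f^{*****}(W^{*},X^{**},Y^{**})\subseteq Z^{*}$ and $f^{******}(Z^{**},W^{*},X^{**})\subseteq Y^{*}$. (3) $f^{i*****}(W^{*},Y^{**},X^{**})\subseteq Z^{*}$ and $f^{i******}(Z^{**},W^{*},Y^{**})\subseteq X^{*}$. (4) $f^{j*****}(W^{*},X^{**},Z^{**})\subseteq Y^{*}$ and $f^{j******}(Y^{**},W^{*},X^{**})\subseteq Z^{*}$. (5) $f^{r*****}(W^{*},Z^{**},Y^{**})\subseteq X^{*}$ and $f^{r******}(X^{**},W^{*},Z^{**})\subseteq Y^{*}$. (6) $f^{t*****}(W^{*},Z^{**},X^{**})\subseteq Y^{*}$ and $f^{t******}(Y^{**},W^{*},Z^{**})\subseteq X^{*}$. (7) $f^{s*****}(W^{*},Y^{**},Z^{**})\subseteq X^{*}$ and $f^{s******}(X^{**},W^{*},Y^{**})\subseteq Z^{*}$.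
   Context: Adjoint: for a bounded tri-linear map $g:E_1\times E_2\times E_3\to E$ of normed spaces, its adjoint is the bounded tri-linear map $g^{*}:E^{*}\times E_1\times E_2\to E_3^{*}$, $\langle g^{*}(e^{*},e_1,e_2),e_3\rangle=\langle e^{*},g(e_1,e_2,e_3)\rangle$. Iterating, $g^{**}:E_3^{**}\times E^{*}\times E_1\to E_2^{*}$, $g^{***}:E_2^{**}\times E_3^{**}\times E^{*}\to E_1^{*}$, $g^{****}:E_1^{**}\times E_2^{**}\times E_3^{**}\to E^{**}$, $g^{*****}:E^{***}\times E_1^{**}\times E_2^{**}\to E_3^{***}$, and so on. Flips: $g^{i}(e_2,e_1,e_3)=g^{j}(e_1,e_3,e_2)=g^{r}(e_3,e_2,e_1)=g^{t}(e_3,e_1,e_2)=g^{s}(e_2,e_3,e_1)=g(e_1,e_2,e_3)$, with $g^{i}:E_2\times E_1\times E_3\to E$, $g^{j}:E_1\times E_3\times E_2\to E$, $g^{r}:E_3\times E_2\times E_1\to E$, $g^{t}:E_3\times E_1\times E_2\to E$, $g^{s}:E_2\times E_3\times E_1\to E$. Superscripts are applied successively from left to right. $f$ is completely regular if its six natural extensions $X^{**}\times Y^{**}\times Z^{**}\to W^{**}$ coincide: $f^{i****i}=f^{j****j}=f^{r****r}=f^{****}=f^{t****s}=f^{s****t}$. Every normed space is identified with its canonical image in its second dual (so $W^*\subseteq W^{***}$, $Z^{**}\subseteq Z^{****}$, and an inclusion ''$\subseteq Z^{*}$'' means that the values, which lie in $Z^{***}$, belong to the canonical image of $Z^*$). $g(A,B,C)$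 denotes the set of values $g(a,b,c)$, $a\in A,b\in B,c\in C$. *)

(* Defs.v *)
From HB Require Import structures.
From mathcomp Require Import all_boot all_order all_algebra.
From mathcomp Require Import complex.
From mathcomp Require Import boolp classical_sets functions reals.
From mathcomp Require Import topology normedtype.

Set Implicit Arguments.
Unset Strict Implicit.
Unset Printing Implicit Defensive.

Import Order.TTheory GRing.Theory Num.Theory.

Local Open Scope classical_set_scope.
Local Open Scope ring_scope.

(* Scalar fields over which an operator norm can be defined: bounded sets of
   nonnegative scalars have suprema. Both the real numbers and the complex
   numbers are instances, and (the nonnegative cone being then that of a
   complete Archimedean field) the theorem of Gelfand and Mazur says that they
   are the only ones. *)
HB.mixin Record NumField_hasNnegSup K of Num.NumField K := {
  nneg_supremums_neq0 : forall A : set K, A !=set0 ->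
    (forall x, A x -> 0 <= x) -> has_ubound A -> supremums A !=set0
}.

#[short(type="scalarFieldType")]
HB.structure Definition ScalarField :=
  {K of Num.NumField K & NumField_hasNnegSup K}.

Lemma real_nneg_supremums (R : realType) (A : set R) : A !=set0 ->
  (forall x, A x -> 0 <= x) -> has_ubound A -> supremums A !=set0.
Proof.
move=> A0 _ Aub; exists (sup A); split; first exact: ub_le_sup.
by move=> M MA; apply: ge_sup.
Qed.

#[non_forgetful_inheritance]
HB.instance Definition _ (R : realType) :=
  NumField_hasNnegSup.Build R (@real_nneg_supremums R).

Lemma complex_nneg_supremums (R : realType) (A : set R[i]) : A !=set0 ->
  (forall x, A x -> 0 <= x) -> has_ubound A -> supremums A !=set0.
Proof.
move=> [x Ax] Age0 [M MA].
have AE z : A z -> z = (complex.Re z)%:C%C.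
  by move=> /Age0; rewrite lecE => /andP[/eqP Im0 _]; case: z Im0 => a b /= ->.
pose B : set R := [set complex.Re z | z in A].
have BP N : ubound A N -> ubound B (complex.Re N).
  by move=> NA _ [z Az <-]; have := NA z Az; rewrite lecE => /andP[].
have B0 : B !=set0 by exists (complex.Re x), x.
exists (sup B)%:C%C; split.
  move=> z Az; rewrite {1}(AE z Az) lecR; apply: ub_le_sup; last by exists z.
  by exists (complex.Re M); exact: BP.
move=> N NA; have := NA x Ax; rewrite {1}(AE x Ax) lecE /= => /andP[ImN _].
by rewrite lecE /= ImN /=; apply: ge_sup => //; exact: BP.
Qed.

HB.instance Definition _ (R : realType) :=
  NumField_hasNnegSup.Build R[i] (@complex_nneg_supremums R).

Section Dual.
Variables (K : scalarFieldType) (E : normedModType K).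

Definition bounded_functional (phi : E -> K^o) : Prop :=
  linear phi /\ exists M : K, forall x, `|phi x| <= M * `|x|.

Definition dual_pred : pred (E -> K^o) :=
  fun phi => `[< bounded_functional phi >].

Record dual := Dual {
  dual_val :> E -> K^o;
  dual_valP : dual_val \in dual_pred
}.

HB.instance Definition _ := [isSub for dual_val].
HB.instance Definition _ := [Choice of dual by <:].

Lemma dual_predP (phi : E -> K^o) :
  reflect (bounded_functional phi) (phi \in dual_pred).
Proof. exact: asboolP. Qed.

Lemma dual_pred_submod_closed : submod_closed dual_pred.
Proof.
split; first by apply/dual_predP; split=> [a x y|];
  [rewrite /= scaler0 addr0|exists 0 => x; rewrite normr0 mul0r].
move=> a f g /dual_predP[fl [M fM]] /dual_predP[gl [N gN]].
apply/dual_predP; split=> [b x y|].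
  rewrite !fctE fl gl /=; rewrite !scalerDr !scalerA (mulrC b a).
  by rewrite addrACA.
exists (`|a| * M + N) => x; rewrite !fctE (le_trans (ler_normD _ _))//.
by rewrite mulrDl lerD// normrM -mulrA ler_wpM2l.
Qed.

HB.instance Definition _ := GRing.isSubmodClosed.Build K (E -> K^o) dual_pred
  dual_pred_submod_closed.
HB.instance Definition _ := [SubChoice_isSubLmodule of dual by <:].

Lemma dualP (phi : dual) : bounded_functional phi.
Proof. exact/dual_predP/dual_valP. Qed.

Lemma dual_linear (phi : dual) : linear phi.
Proof. by case: (dualP phi). Qed.

Definition opnorm (phi : dual) : K :=
  supremum 0 [set `|phi x| | x in [set x : E | `|x| <= 1]].

Let ball_values (phi : dual) : set K :=
  [set `|phi x| | x in [set x : E | `|x| <= 1]].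

Lemma dual0 (phi : dual) : phi 0 = 0.
Proof.
by have := dual_linear phi (-1) 0 0; rewrite scaler0 addr0 scaleN1r addNr.
Qed.

Lemma dualZ (phi : dual) a x : phi (a *: x) = a * phi x.
Proof. by have := dual_linear phi a x 0; rewrite addr0 dual0 addr0. Qed.

Lemma dualD (phi : dual) x y : phi (x + y) = phi x + phi y.
Proof. by have := dual_linear phi 1 x y; rewrite !scale1r. Qed.

Lemma opnorm_supremums (phi : dual) : supremums (ball_values phi) (opnorm phi).
Proof.
have n0 : ball_values phi !=set0.
  by exists `|phi 0|, 0 => //=; rewrite normr0 ler01.
rewrite /opnorm /supremum ifF; last exact/negbTE/set0P.
have [s sP] : supremums (ball_values phi) !=set0.
  apply: nneg_supremums_neq0 => // [_ [x _ <-]//|].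
  have [_ [M MP]] := dualP phi; exists `|M| => _ [x /= x1 <-].
  apply: le_trans (MP x) _.
  have Mx : 0 <= M * `|x| by exact: le_trans (MP x).
  by rewrite -(ger0_norm Mx) normrM normr_id ler_piMr.
exact: xgetI sP.
Qed.

Lemma opnorm_ge0 phi : 0 <= opnorm phi.
Proof.
have [ub _] := opnorm_supremums phi.
apply: (le_trans (normr_ge0 (phi 0))); apply: ub.
by exists 0 => //=; rewrite normr0 ler01.
Qed.

Lemma le_opnorm (phi : dual) x : `|phi x| <= opnorm phi * `|x|.
Proof.
have [ub _] := opnorm_supremums phi.
have [->|x0] := eqVneq x 0; first by rewrite dual0 !normr0 mulr0.
have nx : 0 < `|x| by rewrite normr_gt0.
have : `|phi (`|x|^-1 *: x)| <= opnorm phi.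
  by apply: ub; exists (`|x|^-1 *: x) => //=; rewrite normfZV.
by rewrite dualZ normrM normfV normr_id ler_pdivrMl// mulrC.
Qed.

Lemma opnorm_le (phi : dual) (M : K) : 0 <= M ->
  (forall x, `|phi x| <= M * `|x|) -> opnorm phi <= M.
Proof.
move=> M0 MP; have [_ lub] := opnorm_supremums phi.
by apply: lub => _ [x /= x1 <-]; rewrite (le_trans (MP x))// ler_piMr.
Qed.

Lemma opnormD (phi psi : dual) : opnorm (phi + psi) <= opnorm phi + opnorm psi.
Proof.
apply: opnorm_le; first by rewrite addr_ge0 ?opnorm_ge0.
by move=> x; rewrite mulrDl (le_trans (ler_normD _ _))// lerD ?le_opnorm.
Qed.

Lemma opnormZ (a : K) (phi : dual) : opnorm (a *: phi) = `|a| * opnorm phi.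
Proof.
have le b (psi : dual) : opnorm (b *: psi) <= `|b| * opnorm psi.
  apply: opnorm_le; first by rewrite mulr_ge0 ?opnorm_ge0.
  by move=> x; rewrite normrM -mulrA ler_wpM2l ?le_opnorm.
apply/eqP; rewrite eq_le le /=.
have [->|a0] := eqVneq a 0; first by rewrite normr0 mul0r opnorm_ge0.
have := le a^-1 (a *: phi).
by rewrite scalerA mulVf// scale1r normfV ler_pdivlMl ?normr_gt0.
Qed.

Lemma dual_ext (phi psi : dual) : phi =1 psi -> phi = psi.
Proof. by move=> e; apply/val_inj/funext. Qed.

Lemma opnorm0_eq0 (phi : dual) : opnorm phi = 0 -> phi = 0.
Proof.
move=> n0; apply: dual_ext => x.
by apply/eqP; rewrite -normr_le0 -(mul0r `|x|) -n0 le_opnorm.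
Qed.

HB.instance Definition _ :=
  Lmodule_isNormed.Build K dual opnormD opnormZ opnorm0_eq0.

Lemma le_dual_norm (phi : dual) x : `|phi x| <= `|phi| * `|x|.
Proof. exact: le_opnorm. Qed.

Lemma dual_norm_le (phi : dual) (M : K) : 0 <= M ->
  (forall x, `|phi x| <= M * `|x|) -> `|phi| <= M.
Proof. exact: opnorm_le. Qed.

End Dual.

Notation bidual E := (dual (dual E)).

Section Canonical.
Variables (K : scalarFieldType) (E : normedModType K).

Lemma to_bidual_subproof (x : E) :
  (fun phi : dual E => phi x : K^o) \in @dual_pred K (dual E).
Proof.
apply/dual_predP; split=> [a f g //|].
by exists `|x| => f; rewrite mulrC le_dual_norm.
Qed.

Definition to_bidual (x : E) : bidual E := Dual (to_bidual_subproof x).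

End Canonical.

Record trilin (K : scalarFieldType) (E1 E2 E3 F : normedModType K) := Trilin {
  trilin_val :> E1 -> E2 -> E3 -> F;
  trilin_linear1 : forall y z, linear (fun x => trilin_val x y z);
  trilin_linear2 : forall x z, linear (fun y => trilin_val x y z);
  trilin_linear3 : forall x y, linear (trilin_val x y);
  trilin_bounded : exists M : K, forall x y z,
    `|trilin_val x y z| <= M * `|x| * `|y| * `|z|
}.

Section Adjoint.
Variables (K : scalarFieldType) (E1 E2 E3 F : normedModType K).
Variable g : trilin E1 E2 E3 F.

Lemma trilin_bounded_ge0 : exists2 M : K, 0 <= M &
  forall x y z, `|g x y z| <= M * `|x| * `|y| * `|z|.
Proof.
have [M MP] := trilin_bounded g; exists `|M| => // x y z.
have p0 : 0 <= M * `|x| * `|y| * `|z| by exact: le_trans (MP x y z).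
by rewrite (le_trans (MP x y z))// -(ger0_norm p0) !normrM !normr_id.
Qed.

Lemma adj_subproof (phi : dual F) (x : E1) (y : E2) :
  (fun z => phi (g x y z)) \in @dual_pred K E3.
Proof.
apply/dual_predP; split=> [a z t|].
  by rewrite trilin_linear3 dual_linear.
have [M M0 MP] := trilin_bounded_ge0.
exists (`|phi| * (M * `|x| * `|y|)) => z.
by rewrite (le_trans (le_dual_norm _ _))// -[leRHS]mulrA ler_wpM2l.
Qed.

Definition adj_val (phi : dual F) (x : E1) (y : E2) : dual E3 :=
  Dual (adj_subproof phi x y).

Lemma adj_linear1 x y : linear (fun phi => adj_val phi x y).
Proof. by move=> a f h; exact: dual_ext. Qed.

Lemma adj_linear2 phi y : linear (fun x => adj_val phi x y).
Proof.
by move=> a u v; apply: dual_ext => z /=; rewrite trilin_linear1 dual_linear.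
Qed.

Lemma adj_linear3 phi x : linear (adj_val phi x).
Proof.
by move=> a u v; apply: dual_ext => z /=; rewrite trilin_linear2 dual_linear.
Qed.

Lemma adj_bounded : exists M : K, forall phi x y,
  `|adj_val phi x y| <= M * `|phi| * `|x| * `|y|.
Proof.
have [M M0 MP] := trilin_bounded_ge0; exists M => phi x y.
apply: dual_norm_le => [|z]; first by rewrite !mulr_ge0.
rewrite /= (le_trans (le_dual_norm _ _))// (mulrC M) -!mulrA ler_wpM2l//.
by rewrite !mulrA.
Qed.

Definition adj : trilin (dual F) E1 E2 (dual E3) :=
  Trilin adj_linear1 adj_linear2 adj_linear3 adj_bounded.

Lemma flipi_bounded : exists M : K, forall e2 e1 e3,
  `|g e1 e2 e3| <= M * `|e2| * `|e1| * `|e3|.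
Proof.
by have [M MP] := trilin_bounded g; exists M => y x z; rewrite (mulrAC M) MP.
Qed.

Definition flipi : trilin E2 E1 E3 F :=
  @Trilin K _ _ _ _ (fun e2 e1 e3 => g e1 e2 e3)
    (fun y z => trilin_linear2 g y z) (fun x z => trilin_linear1 g x z)
    (fun y x => trilin_linear3 g x y) flipi_bounded.

Lemma flipj_bounded : exists M : K, forall e1 e3 e2,
  `|g e1 e2 e3| <= M * `|e1| * `|e3| * `|e2|.
Proof.
have [M MP] := trilin_bounded g; exists M => x z y.
by rewrite [leRHS]mulrAC MP.
Qed.

Definition flipj : trilin E1 E3 E2 F :=
  @Trilin K _ _ _ _ (fun e1 e3 e2 => g e1 e2 e3)
    (fun z y => trilin_linear1 g y z) (fun x y => trilin_linear3 g x y)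
    (fun x z => trilin_linear2 g x z) flipj_bounded.

End Adjoint.

Section Flips.
Variables (K : scalarFieldType) (E1 E2 E3 F : normedModType K).
Variable g : trilin E1 E2 E3 F.

Lemma flipr_bounded : exists M : K, forall e3 e2 e1,
  `|g e1 e2 e3| <= M * `|e3| * `|e2| * `|e1|.
Proof.
have [M MP] := trilin_bounded g; exists M => z y x.
by rewrite (mulrAC M) [leRHS]mulrAC (mulrAC M) MP.
Qed.

Definition flipr : trilin E3 E2 E1 F :=
  @Trilin K _ _ _ _ (fun e3 e2 e1 => g e1 e2 e3)
    (fun y x => trilin_linear3 g x y) (fun z x => trilin_linear2 g x z)
    (fun z y => trilin_linear1 g y z) flipr_bounded.

Lemma flipt_bounded : exists M : K, forall e3 e1 e2,
  `|g e1 e2 e3| <= M * `|e3| * `|e1| * `|e2|.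
Proof.
have [M MP] := trilin_bounded g; exists M => z x y.
by rewrite (mulrAC M) [leRHS]mulrAC MP.
Qed.

Definition flipt : trilin E3 E1 E2 F :=
  @Trilin K _ _ _ _ (fun e3 e1 e2 => g e1 e2 e3)
    (fun x y => trilin_linear3 g x y) (fun z y => trilin_linear1 g y z)
    (fun z x => trilin_linear2 g x z) flipt_bounded.

Lemma flips_bounded : exists M : K, forall e2 e3 e1,
  `|g e1 e2 e3| <= M * `|e2| * `|e3| * `|e1|.
Proof.
have [M MP] := trilin_bounded g; exists M => y z x.
by rewrite [leRHS]mulrAC (mulrAC M) MP.
Qed.

Definition flips : trilin E2 E3 E1 F :=
  @Trilin K _ _ _ _ (fun e2 e3 e1 => g e1 e2 e3)
    (fun z x => trilin_linear2 g x z) (fun y x => trilin_linear3 g x y)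
    (fun y z => trilin_linear1 g y z) flips_bounded.

End Flips.

Section Iterated.
Variables (K : scalarFieldType) (E1 E2 E3 F : normedModType K).
Variable g : trilin E1 E2 E3 F.

Definition adj4 : trilin (bidual E1) (bidual E2) (bidual E3) (bidual F) :=
  adj (adj (adj (adj g))).

Definition adj5 :
    trilin (dual (bidual F)) (bidual E1) (bidual E2) (dual (bidual E3)) :=
  adj adj4.

Definition adj6 :
    trilin (bidual (bidual E3)) (dual (bidual F)) (bidual E1)
           (dual (bidual E2)) :=
  adj adj5.

Definition trilin_image (A : set E1) (B : set E2) (C : set E3) : set F :=
  [set w | exists a b c, [/\ A a, B b, C c & w = g a b c]].

End Iterated.

(* The canonical image of E in its second dual; through it E^* is viewed inside
   dual (bidual E), which is convertible to bidual (dual E). *)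
Notation canonical_image E := (range (@to_bidual _ E)).

Section Regularity.
Variables (K : scalarFieldType) (X Y Z W : normedModType K).
Variable f : trilin X Y Z W.

(* Equality of the underlying functions: the records also carry proofs. *)
Definition completely_regular : Prop :=
  [/\ flipi (adj4 (flipi f)) = flipj (adj4 (flipj f))
        :> (bidual X -> bidual Y -> bidual Z -> bidual W),
      flipj (adj4 (flipj f)) = flipr (adj4 (flipr f))
        :> (bidual X -> bidual Y -> bidual Z -> bidual W),
      flipr (adj4 (flipr f)) = adj4 f
        :> (bidual X -> bidual Y -> bidual Z -> bidual W),
      adj4 f = flips (adj4 (flipt f))
        :> (bidual X -> bidual Y -> bidual Z -> bidual W)
    & flips (adj4 (flipt f)) = flipt (adj4 (flips f))
        :> (bidual X -> bidual Y -> bidual Z -> bidual W)].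

End Regularity.

(* Main.v *)
Require Import Defs.
From mathcomp Require Import all_boot all_order all_algebra.
From mathcomp Require Import boolp classical_sets functions reals.
From mathcomp Require Import topology normedtype.

(** Unfolding the adjoints, [adj4 f x y z phi] is the iterated limit of the
    trilinear form [phi \o f] in which [z] is applied innermost and [x]
    outermost; write it XYZ. The six extensions compared by complete
    regularity are the six orders of iteration, and the five flips of [f]
    produce the five orders other than XYZ.

    An iterated limit is always weak-star continuous in its outermost variable.
    Hence saying that XYZ is weak-star continuous in its third variable, which
    is what the inclusion for [adj5] means, amounts to XYZ = ZXY (both sides
    agree when [z] comes from the space itself): [adj5_image_sub]. In the same
    way the inclusion for [adj6] means weak-star continuity in the second
    variable, that is XYZ = YXZ: [adj6_image_sub].

    These two identities give all the others. When one variable comes from the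
    space itself, its place in the order is irrelevant, so what remains is an
    identity between the two orders of the other two variables; that identity
    survives when the variable is made outermost. Restricting XYZ = YXZ to
    vectors of the third space gives ZXY = ZYX; restricting XYZ = ZXY to
    vectors of the second and of the first space gives YXZ = YZX and XYZ = XZY.
    The six orders then coincide: [completely_regular_images].

    Finally, complete regularity does not depend on the order in which the
    three arguments of [f] are listed ([completely_regular_flipi] and
    [completely_regular_flipj], the two transpositions generating the rest), so
    each of the remaining pairs of inclusions is the first pair for a flip of
    [f]. *)

Set Implicit Arguments.
Unset Strict Implicit.
Unset Printing Implicit Defensive.

Local Open Scope classical_set_scope.
Local Open Scope ring_scope.

Section Trilinear.
Variable K : scalarFieldType.
Implicit Types E X Y Z W : normedModType K.

(** Identifies iterated flips with single ones: their underlying functions are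
    convertible, but the linearity and boundedness proofs are not. *)
Lemma trilin_ext X Y Z W (f g : trilin X Y Z W) :
  f = g :> (X -> Y -> Z -> W) -> f = g.
Proof.
case: f g => f f1 f2 f3 fb [g g1 g2 g3 gb] /= fg.
by move: f1 f2 f3 fb; rewrite fg => *; congr Trilin; exact: Prop_irrelevance.
Qed.

(** The functional on the first space to which [adj4 g] applies its first
    argument: the iterated limit with the outermost one left out. *)
Definition adj3 X Y Z W (g : trilin X Y Z W) :
  trilin (bidual Y) (bidual Z) (dual W) (dual X) := adj (adj (adj g)).

Section Extension.
Variables (X Y Z W : normedModType K) (g : trilin X Y Z W).
Implicit Types (x : bidual X) (y : bidual Y) (z : bidual Z) (phi : dual W).

(** An element of the space itself is applied by evaluation, so it may be
    fixed before any limit is taken: it moves to the outermost place, here and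
    in the next lemma. *)
Lemma adj4_bidual2 x (y : Y) z phi :
  adj4 g x (to_bidual y) z phi = adj3 (flipi g) x z phi y.
Proof. by congr (x _); apply: dual_ext => a /=; congr (z _); exact: dual_ext. Qed.

Lemma adj4_bidual3 x y (z : Z) phi :
  adj4 g x y (to_bidual z) phi = adj3 (flipt g) x y phi z.
Proof. by congr (x _); apply: dual_ext => a /=; congr (y _); exact: dual_ext. Qed.

(** The right-hand side is, as a function of [z], the evaluation of [z] at a
    functional on [Z]. If the left-hand side also is, at [psi] say, then taking
    [z] in [Z] identifies the two functionals. *)
Lemma adj5_image_sub :
  trilin_image (adj5 g) (canonical_image (dual W)) setT setT
    `<=` canonical_image (dual Z) <->
  forall x y z phi, adj4 g x y z phi = adj4 (flipt g) z x y phi.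
Proof.
split=> [sub x y z phi|gE _ [_ [x [y [[phi _ <-] _ _ ->]]]]]; last first.
  by exists (adj3 (flipt g) x y phi) => //; apply: dual_ext => z; exact/esym/gE.
have [|psi _ psiE] := sub (adj5 g (to_bidual phi) x y).
  by exists (to_bidual phi), x, y.
have adj4E z' : adj4 g x y z' phi = z' psi.
  by have /(congr1 (fun u : dual (bidual Z) => u z')) /= := psiE.
rewrite adj4E; congr (z _); apply: dual_ext => c.
by rewrite -[LHS](adj4E (to_bidual c)) adj4_bidual3.
Qed.

(** The same comparison in the second variable. The third argument of [adj4 g]
    is then the first of [adj6 g], which ranges over all of [bidual Z] embedded
    in its own second dual. *)
Lemma adj6_image_sub :
  trilin_image (adj6 g) (canonical_image (bidual Z))
      (canonical_image (dual W)) setT `<=` canonical_image (dual Y) <->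
  forall x y z phi, adj4 g x y z phi = adj4 (flipi g) y x z phi.
Proof.
split=> [sub x y z phi|gE _ [_ [_ [x [[z _ <-] [phi _ <-] _ ->]]]]]; last first.
  by exists (adj3 (flipi g) x z phi) => //; apply: dual_ext => y; exact/esym/gE.
have [|psi _ psiE] := sub (adj6 g (to_bidual z) (to_bidual phi) x).
  by exists (to_bidual z), (to_bidual phi), x.
have adj4E y' : adj4 g x y' z phi = y' psi.
  by have /(congr1 (fun u : dual (bidual Y) => u y')) /= := psiE.
rewrite adj4E; congr (y _); apply: dual_ext => b.
by rewrite -[LHS](adj4E (to_bidual b)) adj4_bidual2.
Qed.

Lemma completely_regularP : completely_regular g <->
  forall x y z phi,
    [/\ adj4 g x y z phi = adj4 (flipi g) y x z phi,
        adj4 g x y z phi = adj4 (flipj g) x z y phi,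
        adj4 g x y z phi = adj4 (flipr g) z y x phi,
        adj4 g x y z phi = adj4 (flipt g) z x y phi
      & adj4 g x y z phi = adj4 (flips g) y z x phi].
Proof.
split=> [[ij jr r0 t0 ts] x y z phi|gE].
  have E (u v : bidual X -> bidual Y -> bidual Z -> bidual W) :
    u = v -> u x y z phi = v x y z phi by move=> ->.
  have {ij}ij : adj4 (flipi g) y x z phi = adj4 (flipj g) x z y phi := E _ _ ij.
  have {jr}jr : adj4 (flipj g) x z y phi = adj4 (flipr g) z y x phi := E _ _ jr.
  have {r0}r0 : adj4 (flipr g) z y x phi = adj4 g x y z phi := E _ _ r0.
  have {t0}t0 : adj4 g x y z phi = adj4 (flipt g) z x y phi := E _ _ t0.
  have {ts}ts : adj4 (flipt g) z x y phi = adj4 (flips g) y z x phi := E _ _ ts.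
  by split; rewrite ?ij ?jr ?r0 // t0 ?ts.
have E (u v : bidual X -> bidual Y -> bidual Z -> bidual W) :
  (forall x y z phi, u x y z phi = v x y z phi) -> u = v.
  by move=> uv; do 3 (apply/funext => ?); apply: dual_ext => ?.
split; apply: E => x y z phi; have [gi gj gr gt gs] := gE x y z phi.
- exact: etrans (esym gi) gj.
- exact: etrans (esym gj) gr.
- exact: esym gr.
- exact: gt.
- exact: etrans (esym gt) gs.
Qed.

End Extension.

(** A flip permutes the six orders of iteration. *)
Lemma completely_regular_flipi X Y Z W (g : trilin X Y Z W) :
  completely_regular (flipi g) <-> completely_regular g.
Proof.
have imp E1 E2 E3 F (h : trilin E1 E2 E3 F) :
    completely_regular h -> completely_regular (flipi h).
  move=> /completely_regularP hE; apply/completely_regularP => y x z phi.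
  rewrite (_ : flipi (flipi h) = h); last exact: trilin_ext.
  rewrite (_ : flipj (flipi h) = flips h); last exact: trilin_ext.
  rewrite (_ : flipr (flipi h) = flipt h); last exact: trilin_ext.
  rewrite (_ : flipt (flipi h) = flipr h); last exact: trilin_ext.
  rewrite (_ : flips (flipi h) = flipj h); last exact: trilin_ext.
  by have [<- <- <- <- <-] := hE x y z phi.
split=> [/imp|/imp//].
by rewrite (_ : flipi (flipi g) = g); last exact: trilin_ext.
Qed.

Lemma completely_regular_flipj X Y Z W (g : trilin X Y Z W) :
  completely_regular (flipj g) <-> completely_regular g.
Proof.
have imp E1 E2 E3 F (h : trilin E1 E2 E3 F) :
    completely_regular h -> completely_regular (flipj h).
  move=> /completely_regularP hE; apply/completely_regularP => x z y phi.
  rewrite (_ : flipi (flipj h) = flipt h); last exact: trilin_ext.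
  rewrite (_ : flipj (flipj h) = h); last exact: trilin_ext.
  rewrite (_ : flipr (flipj h) = flips h); last exact: trilin_ext.
  rewrite (_ : flipt (flipj h) = flipi h); last exact: trilin_ext.
  rewrite (_ : flips (flipj h) = flipr h); last exact: trilin_ext.
  by have [<- <- <- <- <-] := hE x y z phi.
split=> [/imp|/imp//].
by rewrite (_ : flipj (flipj g) = g); last exact: trilin_ext.
Qed.

Lemma completely_regular_flips X Y Z W (g : trilin X Y Z W) :
  completely_regular (flips g) <-> completely_regular g.
Proof.
rewrite (_ : flips g = flipj (flipi g)); last exact: trilin_ext.
by rewrite completely_regular_flipj completely_regular_flipi.
Qed.

Lemma completely_regular_flipt X Y Z W (g : trilin X Y Z W) :
  completely_regular (flipt g) <-> completely_regular g.
Proof.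
rewrite (_ : flipt g = flipi (flipj g)); last exact: trilin_ext.
by rewrite completely_regular_flipi completely_regular_flipj.
Qed.

Lemma completely_regular_flipr X Y Z W (g : trilin X Y Z W) :
  completely_regular (flipr g) <-> completely_regular g.
Proof.
rewrite (_ : flipr g = flipi (flips g)); last exact: trilin_ext.
by rewrite completely_regular_flipi completely_regular_flips.
Qed.

(** Two order identities suffice because each of them, restricted to vectors
    of one space, exchanges the limits in the other two variables. *)
Lemma completely_regular_images X Y Z W (g : trilin X Y Z W) :
  completely_regular g <->
  trilin_image (adj5 g) (canonical_image (dual W)) setT setT
      `<=` canonical_image (dual Z) /\
  trilin_image (adj6 g) (canonical_image (bidual Z))
      (canonical_image (dual W)) setT `<=` canonical_image (dual Y).
Proof.
rewrite adj5_image_sub adj6_image_sub completely_regularP.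
split=> [gE|[gt gi] x y z phi].
  by split=> x y z phi; case: (gE x y z phi).
(* XYZ = XZY, from XYZ = ZXY on the first space *)
have xzy : adj4 g x y z phi = adj4 (flipj g) x z y phi.
  rewrite (_ : flipj g = flipi (flipt g)); last exact: trilin_ext.
  congr (x _); apply: dual_ext => a.
  by have := gt (to_bidual a) y z phi; rewrite adj4_bidual2.
(* ZXY = ZYX, from XYZ = YXZ on the third space *)
have zyx : adj4 (flipt g) z x y phi = adj4 (flipr g) z y x phi.
  rewrite (_ : flipr g = flipt (flipi g)); last exact: trilin_ext.
  congr (z _); apply: dual_ext => c.
  by have := gi x y (to_bidual c) phi; rewrite !adj4_bidual3.
(* YXZ = YZX, from XYZ = ZXY on the second space *)
have yzx : adj4 (flipi g) y x z phi = adj4 (flips g) y z x phi.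
  rewrite (_ : flips g = flipt (flipt g)); last exact: trilin_ext.
  congr (y _); apply: dual_ext => b.
  by have := gt x (to_bidual b) z phi; rewrite adj4_bidual2 adj4_bidual3.
by split; rewrite -?xzy -?zyx -?yzx -?gt -?gi.
Qed.

End Trilinear.

Theorem theorem7 (K : scalarFieldType) (X Y Z W : normedModType K)
    (f : trilin X Y Z W) :
  [<->
   completely_regular f;
   trilin_image (adj5 f) (canonical_image (dual W)) setT setT
     `<=` canonical_image (dual Z)
   /\ trilin_image (adj6 f) (canonical_image (bidual Z))
        (canonical_image (dual W)) setT
     `<=` canonical_image (dual Y);
   trilin_image (adj5 (flipi f)) (canonical_image (dual W)) setT setT
     `<=` canonical_image (dual Z)
   /\ trilin_image (adj6 (flipi f)) (canonical_image (bidual Z))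
        (canonical_image (dual W)) setT
     `<=` canonical_image (dual X);
   trilin_image (adj5 (flipj f)) (canonical_image (dual W)) setT setT
     `<=` canonical_image (dual Y)
   /\ trilin_image (adj6 (flipj f)) (canonical_image (bidual Y))
        (canonical_image (dual W)) setT
     `<=` canonical_image (dual Z);
   trilin_image (adj5 (flipr f)) (canonical_image (dual W)) setT setT
     `<=` canonical_image (dual X)
   /\ trilin_image (adj6 (flipr f)) (canonical_image (bidual X))
        (canonical_image (dual W)) setT
     `<=` canonical_image (dual Y);
   trilin_image (adj5 (flipt f)) (canonical_image (dual W)) setT setT
     `<=` canonical_image (dual Y)
   /\ trilin_image (adj6 (flipt f)) (canonical_image (bidual Y))
        (canonical_image (dual W)) setT
     `<=` canonical_image (dual X);
   trilin_image (adj5 (flips f)) (canonical_image (dual W)) setT setT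
     `<=` canonical_image (dual X)
   /\ trilin_image (adj6 (flips f)) (canonical_image (bidual X))
        (canonical_image (dual W)) setT
     `<=` canonical_image (dual Z)].
Proof.
tfae.
- by move=> /completely_regular_images.
- by move=> /completely_regular_images/completely_regular_flipi
    /completely_regular_images.
- by move=> /completely_regular_images/completely_regular_flipi
    /completely_regular_flipj/completely_regular_images.
- by move=> /completely_regular_images/completely_regular_flipj
    /completely_regular_flipr/completely_regular_images.
- by move=> /completely_regular_images/completely_regular_flipr
    /completely_regular_flipt/completely_regular_images.
- by move=> /completely_regular_images/completely_regular_flipt
    /completely_regular_flips/completely_regular_images.
- by move=> /completely_regular_images/completely_regular_flips.
Qed.
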